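(* Let $d$ be an integer with $0\leq d<\infty$. Let $X$ be a normal space of covering dimension $d$. Let $n\geq1$ be an integer. Let $f:X\to M_n^{\mathrm{sa}}$ and $\epsilon:X\to\mathbb{R}_{>0}$ be continuous. Then there exists a continuous map $g:X\to M_n^{\mathrm{sa}}$ such that for all $x\in X$: (1) $\|f(x)-g(x)\|<\epsilon(x)$; (2) all eigenvalues of $g(x)$ have multiplicity at most $\lceil d/2\rceil+1$; (3) at most $\lceil d/2\rceil$ (distinct) eigenvalues of $g(x)$ have multiplicity more than $1$.
   Context: $M_n^{\mathrm{sa}}$ is the set of self-adjoint complex $n\times n$ matrices (with the operator norm); $\lceil t\rceil$ is the smallest integer $\geq t$. A topological space is normal if any two disjoint closed subsets have disjoint neighborhoods (no Hausdorff assumption). Covering dimension: a space $X$ has dimension at most $d$ if every open covering of $X$ has an open refinement $(V_j)_{j\in J}$ such that each $x\in X$ lies in $V_j$ for at most $d+1$ indices $j$; $\dim X$ is the smallest such $d\in\{0,1,2,\dots\}$ (or $\infty$ if none exists). *)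

(* Defs.v *)
From HB Require Import structures.
From mathcomp Require Import all_boot all_order all_algebra.
From mathcomp Require Import all_classical all_reals all_analysis.
From mathcomp Require Import complex.

Set Implicit Arguments.
Unset Strict Implicit.
Unset Printing Implicit Defensive.

Import Order.TTheory GRing.Theory Num.Theory.
Import numFieldNormedType.Exports.
Import Normc.

Local Open Scope classical_set_scope.
Local Open Scope complex_scope.
Local Open Scope ring_scope.

(* The metric topology of [R[i]], from which ['M[R[i]]_n] gets its topology.
   The library only provides it on the alias [R[i]^o]. *)
HB.instance Definition _ (R : realType) := NormedModule.copy R[i] R[i]^o.

Section CoveringDimension.
Variable X : topologicalType.

Definition open_cover (I : Type) (U : I -> set X) : Prop :=
  (forall i, open (U i)) /\ \bigcup_i U i = [set: X].

Definition refines (I J : Type) (V : J -> set X) (U : I -> set X) : Prop :=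
  forall j, exists i, V j `<=` U i.

Definition covering_dim_le (d : nat) : Prop :=
  forall (I : Type) (U : I -> set X), open_cover U ->
  exists (J : Type) (V : J -> set X),
    [/\ open_cover V, refines V U &
        forall x, ([set j | V j x] #<= `I_d.+1)%card].

(* In particular the empty space has dimension 0. *)
Definition has_covering_dim (d : nat) : Prop :=
  covering_dim_le d /\ forall d', covering_dim_le d' -> (d <= d')%N.

End CoveringDimension.

Section ComplexMatrices.
Variable R : realType.

Definition enorm (n : nat) (v : 'cV[R[i]]_n) : R :=
  Num.sqrt (\sum_i normc (v i 0) ^+ 2).

Definition opnorm (n : nat) (A : 'M[R[i]]_n) : R :=
  sup [set enorm (A *m v) | v in [set v : 'cV[R[i]]_n | enorm v <= 1]].

(* [eigenspace] uses row vectors, [v *m A = a *: v]; the dimension is the same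
   as that of the space of column eigenvectors. *)
Definition eigenmult (n : nat) (A : 'M[R[i]]_n) (a : R[i]) : nat :=
  \rank (eigenspace A a).

Lemma normc_ge0 (z : R[i]) : 0 <= normc z.
Proof. by case: z => a b; exact: sqrtr_ge0. Qed.

Lemma ler_normc_sum (I : Type) (s : seq I) (F : I -> R[i]) :
  normc (\sum_(i <- s) F i) <= \sum_(i <- s) normc (F i).
Proof.
elim/big_rec2: _ => [|i y x _ ih].
  by rewrite /normc /= expr0n /= addr0 sqrtr0.
by apply: le_trans (le_normcD _ _) _; rewrite lerD2l.
Qed.

Lemma normc_le_enorm n (v : 'cV[R[i]]_n) k : normc (v k 0) <= enorm v.
Proof.
rewrite -[leLHS]ger0_norm ?normc_ge0// -sqrtr_sqr ler_wsqrtr//.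
by rewrite (bigD1 k)//= lerDl sumr_ge0// => ? _; rewrite sqr_ge0.
Qed.

Lemma enorm_le_sum n (v : 'cV[R[i]]_n) : enorm v <= \sum_k normc (v k 0).
Proof.
have S0 : 0 <= \sum_k normc (v k 0) by rewrite sumr_ge0// => *; exact: normc_ge0.
rewrite -[leRHS]ger0_norm// -sqrtr_sqr ler_wsqrtr// expr2 mulr_suml.
apply: ler_sum => k _; rewrite expr2 ler_wpM2l ?normc_ge0//.
by rewrite (bigD1 k)//= lerDl sumr_ge0// => *; exact: normc_ge0.
Qed.

Lemma enorm_mulmx_le n (A : 'M[R[i]]_n) (v : 'cV[R[i]]_n) : enorm v <= 1 ->
  enorm (A *m v) <= \sum_i \sum_j normc (A i j).
Proof.
move=> v1; apply: le_trans (enorm_le_sum _) _; apply: ler_sum => k _.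
rewrite mxE; apply: le_trans (ler_normc_sum _ _) _; apply: ler_sum => j _.
rewrite normcM ler_piMr ?normc_ge0//.
exact: le_trans (normc_le_enorm _ _) v1.
Qed.

Lemma opnorm_has_sup n (A : 'M[R[i]]_n) :
  has_sup [set enorm (A *m v) | v in [set v : 'cV[R[i]]_n | enorm v <= 1]].
Proof.
split.
  exists (enorm (A *m 0)); exists 0 => //=.
  rewrite /enorm big1 ?sqrtr0// => k _.
  by rewrite mxE /normc /= expr0n /= addr0 sqrtr0 expr0n.
exists (\sum_i \sum_j normc (A i j)) => _ [v v1 <-].
exact: enorm_mulmx_le.
Qed.

Lemma opnorm_le_sum n (A : 'M[R[i]]_n) :
  opnorm A <= \sum_i \sum_j normc (A i j).
Proof.
apply: ge_sup; first by case: (opnorm_has_sup A).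
by move=> _ [v v1 <-]; exact: enorm_mulmx_le.
Qed.

Lemma normc_le_opnorm n (A : 'M[R[i]]_n) k l : normc (A k l) <= opnorm A.
Proof.
pose v : 'cV[R[i]]_n := delta_mx l 0.
have v1 : enorm v <= 1.
  rewrite /enorm (bigD1 l)//= big1 => [|j jl]; rewrite mxE ?eqxx/=.
    by rewrite /normc /= expr0n/= !(expr1n, addr0, sqrtr1).
  by rewrite (negbTE jl) /normc /= expr0n/= addr0 sqrtr0 expr0n.
have <- : (A *m v) k 0 = A k l.
  rewrite mxE (bigD1 l)//= big1 => [|j jl]; rewrite mxE ?eqxx/=.
    by rewrite mulr1 addr0.
  by rewrite (negbTE jl) mulr0.
apply: le_trans (normc_le_enorm _ _) _.
by apply: ub_le_sup; [case: (opnorm_has_sup A)|exists v].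
Qed.

(* The topology on matrices is the one of the operator norm. *)
Lemma nbhs_opnormP n (A : 'M[R[i]]_n) (U : set 'M[R[i]]_n) :
  nbhs A U <->
  exists2 e : R, 0 < e & forall B, opnorm (A - B) < e -> U B.
Proof.
have normE (z : R[i]) : `|z| = (normc z)%:C by [].
split=> [/nbhs_ballP[[a b] /= ab0 AU]|[e e0 AU]].
  move: ab0; rewrite ltcE/= => /andP[/eqP b0 a0]; exists a => // B ABa.
  apply: AU; split=> [|i j]; first by rewrite ltcE /= b0 eqxx.
  rewrite -ball_normE /ball_/= normE b0 ltcR.
  by apply: le_lt_trans ABa; have := normc_le_opnorm (A - B) i j; rewrite !mxE.
apply/nbhs_ballP; exists (e / (n * n).+1%:R)%:C => /=.
  by rewrite ltcR divr_gt0.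
move=> B [_ ABe]; apply: AU; apply: le_lt_trans (opnorm_le_sum _) _.
apply: (@le_lt_trans _ _ (\sum_(i < n) \sum_(j < n) e / (n * n).+1%:R)).
  apply: ler_sum => i _; apply: ler_sum => j _; apply/ltW; rewrite !mxE.
  by have := ABe i j; rewrite -ball_normE /ball_/= normE ltcR.
rewrite !sumr_const !card_ord -mulrnA -[ltLHS]mulr_natl mulrCA.
by rewrite -[ltRHS]mulr1 ltr_pM2l// ltr_pdivrMr// mul1r ltr_nat.
Qed.

End ComplexMatrices.

(* Main.v *)
Require Import Defs.
From HB Require Import structures.
From mathcomp Require Import all_boot all_order all_algebra.
From mathcomp Require Import all_classical all_reals all_analysis.
From mathcomp Require Import complex.
From mathcomp Require Import -(notations) mpoly.
From mathcomp Require Import zify ring lra.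

Import Order.TTheory GRing.Theory Num.Theory.
Import numFieldNormedType.Exports.
Import Normc.

Local Open Scope classical_set_scope.
Local Open Scope complex_scope.
Local Open Scope ring_scope.

Set Implicit Arguments.
Unset Strict Implicit.
Unset Printing Implicit Defensive.

(* Put k = ceil(d/2) + 1.  Call a matrix degenerate if it leaves invariant some
   k-dimensional space of row vectors with vanishing first entry.  An eigenspace
   of dimension m meets that hyperplane in dimension at least m - 1, so a
   Hermitian matrix violating (2) or (3) is degenerate.  Degenerate Hermitian
   matrices have real codimension 2k > d, hence a generic choice of the values
   at the vertices of a d-dimensional nerve avoids them.  Concretely, the
   complexification of {degenerate matrices} + {span of d given matrices} is
   the image of a polynomial map in fewer than n^2 variables, so some nonzero
   polynomial vanishes on it, and a point outside its zero set can be found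
   near any Hermitian matrix.  Pulling back a countable cover along (f, eps),
   the dimension hypothesis gives a countable locally finite cover of order at
   most d + 1, and g is the mean, weighted by subordinate functions, of the
   generic points attached to its members. *)

(** * Algebraic dependence of polynomials *)

(** For N above (c+1)^q one has (cN+1)^q <= ((c+1)N)^q < N^(q+1) <= N^p. *)
Lemma expn_beats_linear (c p q : nat) : (q < p)%N ->
  exists N, ((c * N).+1 ^ q < N ^ p)%N.
Proof.
move=> qp; exists (c.+1 ^ q).+1; set N := (c.+1 ^ q).+1.
apply: (@leq_trans (N ^ q.+1)); last by rewrite leq_pexp2l.
apply: (@leq_ltn_trans ((c.+1 * N) ^ q)).
  by case: (q) => [|q']; rewrite ?expn0// leq_exp2r// mulSn -addn1 addnC leq_add2r.
by rewrite expnMn expnS ltn_pmul2r// expn_gt0.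
Qed.

Lemma msize_prodX_le (K : fieldType) (q : nat) (I : finType) (P : I -> mpoly q K)
    (e : nat) (b : I -> nat) :
  (forall i, mmeasure mdeg (P i) <= e.+1)%N ->
  (mmeasure mdeg (\prod_i P i ^+ b i) <= (\sum_i b i * e).+1)%N.
Proof.
move=> Pe.
have mulB (s t : nat) (p r : mpoly q K) : (mmeasure mdeg p <= s.+1)%N ->
    (mmeasure mdeg r <= t.+1)%N -> (mmeasure mdeg (p * r) <= (s + t).+1)%N.
  move=> ps rt; have [->|p0] := eqVneq p 0; first by rewrite mul0r msize0.
  have [->|r0] := eqVneq r 0; first by rewrite mulr0 msize0.
  rewrite msizeM// -subn1 leq_subLR; apply: leq_trans (leq_add ps rt) _.
  by rewrite addSn addnS add1n.
elim/big_rec2: _ => [|i p s _ ih]; first by rewrite msize1.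
apply: (mulB) => //; elim: (b i) => [|k ihk]; first by rewrite expr0 msize1.
by rewrite exprS mulSn; apply: (mulB).
Qed.

(* Comparing dimensions: there are N ^ #|I| monomials of degree < N in each
   variable, while their values lie in a space of dimension O(N ^ q). *)
Lemma algebraic_dependence (K : fieldType) (q : nat) (I : finType)
    (P : I -> mpoly q K) : (q < #|I|)%N ->
  exists (N : nat) (c : {ffun I -> 'I_N} -> K),
    (exists b, c b != 0) /\ \sum_b c b *: \prod_i P i ^+ (b i : nat) = 0.
Proof.
move=> qI.
pose e := (\max_i mmeasure mdeg (P i))%N.
have Pe i : (mmeasure mdeg (P i) <= e.+1)%N.
  by apply: leqW; apply: (leq_bigmax i).
have [N Nlt] := expn_beats_linear (#|I| * e) qI.
(* [D] bounds the degree of every product with exponents below [N], so [M] below records all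
   coefficients that can be nonzero, and it has more rows than columns. *)
set D := (#|I| * e * N)%N in Nlt.
pose B := {ffun I -> 'I_N}; pose C := {ffun 'I_q -> 'I_D.+1}.
pose mono (f : C) : multinom q := Multinom [tuple (f j : nat) | j < q].
pose T (b : B) := \prod_i P i ^+ (b i : nat).
pose M : 'M[K]_(#|B|, #|C|) :=
  \matrix_(i, j) mcoeff (mono (enum_val j)) (T (enum_val i)).
have : kermx M != 0.
  rewrite -mxrank_eq0 mxrank_ker subn_eq0 -ltnNge.
  apply: leq_ltn_trans (rank_leq_col _) _.
  by rewrite !card_ffun !card_ord.
case/rowV0Pn => v /sub_kermxP vM v0.
exists N, (fun b => v 0 (enum_rank b)); split.
  apply: contrapT => /forallNP v_eq0; move/negP: v0; apply; apply/eqP/rowP => i.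
  by have /negP := v_eq0 (enum_val i); rewrite negbK enum_valK mxE => /eqP.
apply/mpolyP => m; rewrite mcoeff0 raddf_sum /=.
under eq_bigr do rewrite mcoeffZ.
have [mD|Dm] := leqP (mdeg m) D.
  have mjD j : (m j < D.+1)%N.
    rewrite ltnS; apply: leq_trans mD; rewrite mdegE.
    by rewrite (bigD1 j)//= leq_addr.
  pose f : C := [ffun j => Ordinal (mjD j)].
  have -> : m = mono f by apply/mnmP => j; rewrite mnmE /= ffunE.
  transitivity ((v *m M) 0 (enum_rank f)); last by rewrite vM mxE.
  rewrite mxE (reindex (@enum_val B B)) /=; last first.
    by exists enum_rank => x _; rewrite ?enum_valK ?enum_rankK.
  by apply: eq_bigr => i _; rewrite mxE enum_valK enum_rankK.
rewrite big1// => b _; rewrite [mcoeff _ _]memN_msupp_eq0 ?mulr0//.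
apply: msize_mdeg_ge; apply: leq_trans Dm.
apply: leq_trans (msize_prodX_le _ _) _; [exact: Pe|].
rewrite ltnS; apply: (@leq_trans (\sum_(i : I) N * e)).
  by apply: leq_sum => i _; rewrite leq_mul2r ltnW ?orbT.
by rewrite sum_nat_const /D -mulnA (mulnC N).
Qed.

Lemma base_expansion_inj (N m : nat) (a b : 'I_m -> 'I_N) :
  (\sum_i a i * N ^ i = \sum_i b i * N ^ i)%N -> a =1 b.
Proof.
elim: m a b => [|m ih] a b; first by move=> _ [].
have step (h : 'I_m.+1 -> 'I_N) : (\sum_i h i * N ^ i =
    h ord0 + (\sum_(i < m) h (lift ord0 i) * N ^ i) * N)%N.
  rewrite big_ord_recl expn0 muln1; congr addn; rewrite big_distrl /=.
  by apply: eq_bigr => i _; rewrite -mulnA -expnSr.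
rewrite !step => E.
have E0 : a ord0 = b ord0 :> nat.
  have := congr1 (modn^~ N) E.
  by rewrite /= ![(_ + _ * N)%N]addnC !modnMDl !modn_small.
have N0 : (0 < N)%N by case: (N) (a ord0) => // -[].
have /ih E1 : (\sum_(i < m) a (lift ord0 i) * N ^ i =
    \sum_(i < m) b (lift ord0 i) * N ^ i)%N.
  by apply/eqP; rewrite -(eqn_pmul2r N0) -(eqn_add2l (a ord0)) E E0.
move=> i; by case: (unliftP ord0 i) => [j|] ->; [exact: E1|exact: val_inj].
Qed.

(** Only finitely many of the points 1/k are roots. They are real, which keeps perturbed matrices
    Hermitian, and tend to 0, which keeps perturbations small. *)
Lemma poly_nonroot (K : numFieldType) (p : {poly K}) : p != 0 ->
  forall m, exists k : nat, (m < k)%N /\ p.[k%:R^-1] != 0.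
Proof.
move=> p0 m; apply: contrapT => /forallNP H.
have R k : root p ((m + k).+1%:R^-1).
  have := H (m + k).+1; rewrite ltnS leq_addr => /not_andP[//|/negP].
  by rewrite negbK.
have := @max_poly_roots _ p [seq (m + k).+1%:R^-1 | k <- iota 0 (size p)] p0.
rewrite size_map size_iota ltnn => F; suff : false by [].
apply: F; first by apply/allP => _ /mapP[k _ ->]; exact: R.
rewrite map_inj_uniq ?iota_uniq// => i j /invr_inj/eqP.
by rewrite eqr_nat eqSS eqn_add2l => /eqP.
Qed.

(* Kronecker substitution: for y i = z ^ (N ^ rank i) distinct monomials of
   degree < N in each variable become distinct powers of z. *)
Lemma monomials_free (K : numFieldType) (I : finType) (N : nat)
    (c : {ffun I -> 'I_N} -> K) : (exists b, c b != 0) ->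
  exists y : I -> K, \sum_b c b * \prod_i y i ^+ b i != 0.
Proof.
move=> [b0 cb0].
pose code (b : {ffun I -> 'I_N}) := (\sum_i b i * N ^ enum_rank i)%N.
have codeE b : code b = (\sum_(j < #|I|) b (enum_val j) * N ^ j)%N.
  rewrite /code (reindex (@enum_val I I)) /=; last first.
    by exists enum_rank => x _; rewrite ?enum_valK ?enum_rankK.
  by apply: eq_bigr => i _; rewrite enum_valK.
have code_inj : injective code.
  move=> a b; rewrite !codeE => /base_expansion_inj E; apply/ffunP => i.
  by have := E (enum_rank i); rewrite enum_rankK.
pose p : {poly K} := \sum_b c b *: 'X^(code b).
have p0 : p != 0.
  apply: contraNneq cb0 => p0; have := coef0 K (code b0).
  rewrite -p0 coef_sum (bigD1 b0)//= coefZ coefXn eqxx mulr1 big1 ?addr0.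
    by move=> ->.
  move=> b bb0; rewrite coefZ coefXn; case: eqP => [/code_inj E|]; last first.
    by rewrite mulr0.
  by rewrite E eqxx in bb0.
have [k [_ pk]] := poly_nonroot p0 0.
exists (fun i => k%:R^-1 ^+ (N ^ enum_rank i)).
rewrite (_ : \sum_b _ = p.[k%:R^-1])// horner_sum; apply: eq_bigr => b _.
rewrite hornerZ hornerXn; congr (_ * _); rewrite /code expr_sum.
by apply: eq_bigr => i _; rewrite -exprM mulnC.
Qed.

(** * Functions that are polynomial along lines *)

(** Implied by being polynomial in the entries, and enough to leave a zero set along a line by
    counting roots. *)
Definition line_polynomial (K : fieldType) (V : lmodType K) (F : V -> K) :=
  forall a b : V, exists p : {poly K}, forall z, F (a + z *: b) = p.[z].

Lemma line_polynomial_prod (K : fieldType) (V : lmodType K) (I : Type)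
    (s : seq I) (P : pred I) (F : I -> V -> K) :
  (forall i, line_polynomial (F i)) ->
  line_polynomial (fun v => \prod_(i <- s | P i) F i v).
Proof.
move=> lF a b; have [p pE] := choice (fun i => lF i a b).
exists (\prod_(i <- s | P i) p i) => z.
by rewrite horner_prod; apply: eq_bigr => i _; rewrite pE.
Qed.

Lemma line_polynomial_sum (K : fieldType) (V : lmodType K) (I : Type)
    (s : seq I) (P : pred I) (F : I -> V -> K) :
  (forall i, line_polynomial (F i)) ->
  line_polynomial (fun v => \sum_(i <- s | P i) F i v).
Proof.
move=> lF a b; have [p pE] := choice (fun i => lF i a b).
exists (\sum_(i <- s | P i) p i) => z.
by rewrite horner_sum; apply: eq_bigr => i _; rewrite pE.
Qed.

Lemma line_polynomial_monomial (K : fieldType) (V : lmodType K) (c : K) (e : nat)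
    (F : V -> K) : line_polynomial F -> line_polynomial (fun v => c * F v ^+ e).
Proof.
move=> lF a b; have [p pE] := lF a b; exists (c *: p ^+ e) => z.
by rewrite hornerZ horner_exp pE.
Qed.

Lemma line_polynomial_coord (K : fieldType) m n (i : 'I_m) (j : 'I_n) :
  line_polynomial (fun A : 'M[K]_(m, n) => A i j).
Proof.
move=> A B; exists ((A i j)%:P + (B i j) *: 'X) => z.
by rewrite !mxE hornerD hornerC hornerZ hornerX mulrC.
Qed.

(** On the line through a point where [F i] is nonzero and one where the remaining product is, both
    restrict to nonzero polynomials, which have a common nonroot. *)
Lemma line_polynomial_prod_neq0 (K : numFieldType) (V : lmodType K) (I : Type)
    (s : seq I) (F : I -> V -> K) :
  (forall i, line_polynomial (F i)) -> (forall i, exists v, F i v != 0) ->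
  exists v, \prod_(i <- s) F i v != 0.
Proof.
move=> lF F0; elim: s => [|i s [v vs]].
  by exists 0; rewrite big_nil oner_neq0.
have [u ui] := F0 i.
have [p pE] := lF i u (v - u).
have [r rE] := line_polynomial_prod s xpredT lF u (v - u).
have p0 : p != 0.
  by apply: contraNneq ui => p0; rewrite -[u]addr0 -(scale0r (v - u)) pE p0 horner0.
have r0 : r != 0.
  apply: contraNneq vs => r0; have := rE 1; rewrite scale1r addrC subrK => ->.
  by rewrite r0 horner0.
have [k [_]] := poly_nonroot (mulf_neq0 p0 r0) 0.
rewrite hornerM -pE -rE => H.
by exists (u + k%:R^-1 *: (v - u)); rewrite big_cons.
Qed.

(** * Hermitian matrices with an invariant subspace in a hyperplane *)

Definition selection (R : pzSemiRingType) k n (f : 'I_k -> 'I_n) : 'M[R]_(k, n) :=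
  \matrix_(i, j) (f i == j)%:R.

Lemma mul_selection_tr (R : pzSemiRingType) k n m (f : 'I_k -> 'I_n) (A : 'M[R]_(m, n)) :
  A *m (selection R f)^T = colsub f A.
Proof.
apply/matrixP => i j; rewrite !mxE (bigD1 (f j))//= !mxE eqxx mulr1.
by rewrite big1 ?addr0// => l lj; rewrite !mxE eq_sym (negbTE lj) mulr0.
Qed.

Lemma mul_selection (R : pzSemiRingType) k n m (f : 'I_k -> 'I_n) (A : 'M[R]_(n, m)) :
  selection R f *m A = rowsub f A.
Proof.
apply/matrixP => i j; rewrite !mxE (bigD1 (f i))//= !mxE eqxx mul1r.
by rewrite big1 ?addr0// => l lj; rewrite !mxE eq_sym (negbTE lj) mul0r.
Qed.

(* A Hermitian matrix with an invariant subspace (the rows of [Y], normalized to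
   the identity on the columns selected by [f]) splits into a part on that
   subspace and a part on its orthogonal complement.  [Y'] stands for the
   adjoint of [Y], but is left independent of [Y] to make the parametrization
   polynomial; if [Y] and [Y'] also vanish at one further index and [B] vanishes
   on the rows and columns selected by [f], then n^2 - 2k parameters remain. *)
Definition normal_form (R : pzRingType) k n (f : 'I_k -> 'I_n) (Y : 'M[R]_(k, n))
    (Y' : 'M[R]_(n, k)) (D : 'M[R]_k) (B : 'M[R]_n) : 'M[R]_n :=
  Y' *m D *m Y +
  (1%:M - (selection R f)^T *m Y) *m B *m (1%:M - Y' *m selection R f).

Lemma map_normal_form (R S : nzRingType) (h : {rmorphism R -> S}) k n
    (f : 'I_k -> 'I_n) (Y : 'M[R]_(k, n)) Y' D B :
  map_mx h (normal_form f Y Y' D B) =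
  normal_form f (map_mx h Y) (map_mx h Y') (map_mx h D) (map_mx h B).
Proof.
have hsel : map_mx h (selection R f) = selection S f.
  by apply/matrixP => i j; rewrite !mxE rmorph_nat.
by rewrite /normal_form map_mxD !map_mxM !map_mxB !map_mxM !map_mx1 -map_trmx hsel.
Qed.

Section InvariantSubspace.
Variable C : numClosedFieldType.
Implicit Types n k d : nat.
Local Open Scope sesquilinear_scope.
Local Notation "M ^t*" := (M ^t (@Num.conj C)) (at level 30) : ring_scope.

(** The degenerate matrices of the overview: the rows of [Y] are a basis of the invariant space, and
    [M] is the action of [S] on it. *)
Definition invariant_in_hyperplane k n (S : 'M[C]_n.+1) :=
  exists (Y : 'M[C]_(k, n.+1)) (M : 'M[C]_k),
    [/\ row_free Y, col 0 Y = 0 & Y *m S = M *m Y].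

(** If v Y Y* = 0, then |v Y|^2 = 0, so v = 0 by independence of the rows. *)
Lemma gram_unitmx k n (Y : 'M[C]_(k, n)) :
  row_free Y -> Y *m Y^t* \in unitmx.
Proof.
move=> fY; rewrite -row_free_unit -kermx_eq0; apply/rowV0P => v /sub_kermxP vYY.
apply/eqP; rewrite -(mulmx_free_eq0 _ fY); apply/eqP/rowP => j; rewrite [RHS]mxE.
have : \sum_j `|(v *m Y) 0 j| ^+ 2 = 0.
  transitivity ((v *m Y *m (v *m Y)^t*) 0 0).
    by rewrite [RHS]mxE; apply: eq_bigr => i _; rewrite normCK !mxE.
  by rewrite trmx_mul map_mxM /= mulmxA -(mulmxA v) vYY mul0mx mxE.
move=> /psumr_eq0P/(_ j isT)/eqP; rewrite sqrf_eq0 normr_eq0 => E.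
by apply/eqP; apply: E => i _; rewrite exprn_ge0.
Qed.

(** The columns chosen by [f] form an invertible minor of the basis, by which it is normalized.
    Column 0 vanishes, so it is never chosen. *)
Lemma hermitian_normal_form k n (S : 'M[C]_n.+1) :
  S \is hermsymmx -> invariant_in_hyperplane k S ->
  exists (f : {ffun 'I_k -> 'I_n.+1}) (Y : 'M[C]_(k, n.+1)) (Y' : 'M[C]_(n.+1, k))
      (D : 'M[C]_k) (B : 'M[C]_n.+1),
    [/\ injective f, forall i, f i != 0,
       [/\ colsub f Y = 1%:M, rowsub f Y' = 1%:M, col 0 Y = 0 & row 0 Y' = 0],
       rowsub f B = 0 /\ colsub f B = 0 &
       S = normal_form f Y Y' D B].
Proof.
move=> /is_hermitianmxP; rewrite expr0 scale1r => Sherm [Z [N [fZ Z0 ZS]]].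
have fullZ : row_full Z^T by rewrite -col_leq_rank mxrank_tr row_leq_rank.
pose f : {ffun 'I_k -> 'I_n.+1} := fullrankfun fullZ.
have f_inj : injective f by exact: fullrankfun_inj.
pose G := colsub f Z.
have uG : G \in unitmx.
  rewrite -unitmx_tr (_ : G^T = rowsub f Z^T).
    exact: fullrowsub_unit.
  by apply/matrixP => i j; rewrite !mxE.
pose F := selection C f; pose Y := invmx G *m Z; pose Y' := Y^t*.
have YF : Y *m F^T = 1%:M by rewrite -mulmxA mul_selection_tr mulVmx.
have FY' : F *m Y' = 1%:M.
  have := congr1 (fun A => A^t*) YF.
  rewrite trmx_mul trmxK map_mxM /= trmx1 map_mx1 => <-; congr (_ *m _).
  by apply/matrixP => i j; rewrite !mxE conjC_nat.
have FF : F *m F^T = 1%:M.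
  rewrite mul_selection_tr; apply/matrixP => i j; rewrite !mxE.
  by rewrite (inj_eq f_inj).
have Y0 : col 0 Y = 0 by rewrite /Y colE -mulmxA -colE Z0 mulmx0.
pose M := invmx G *m N *m G.
have YS : Y *m S = M *m Y.
  by rewrite /Y -mulmxA ZS /M !mulmxA mulmxK.
have SY' : S *m Y' = Y' *m M^t*.
  have := congr1 (fun A => A^t*) YS.
  by rewrite (trmx_mul Y S) (trmx_mul M Y) !map_mxM -Sherm.
have fY : row_free Y.
  by rewrite /row_free mxrankMfree// mxrank_unit// unitmx_inv.
have uH := gram_unitmx fY; set H := Y *m Y^t* in uH.
(* Both [M *m H] and [H *m M^t*] equal Y S Y'. Hence Y' D Y agrees with [S] after multiplication by
   [Y] on the left or by [Y'] on the right, and the remainder [S1] is annihilated there. *)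
have HM : invmx H *m M *m H = M^t*.
  rewrite -mulmxA (_ : M *m H = H *m M^t*) ?mulKmx//.
  by rewrite /H mulmxA -YS -mulmxA -/Y' SY' mulmxA.
pose D := invmx H *m M; pose S1 := S - Y' *m D *m Y.
have YS1 : Y *m S1 = 0.
  by rewrite mulmxBr YS /D !mulmxA mulmxV// mul1mx subrr.
have S1Y' : S1 *m Y' = 0.
  by rewrite mulmxBl SY' -(mulmxA _ Y Y') -(mulmxA Y' D) -/H [D *m H]HM subrr.
(* [Q] zeroes the chosen coordinates. The factors 1 - F^T Y and 1 - Y' F absorb [Q] and fix [S1], so
   Q S1 Q determines [S1]. *)
pose Q := 1%:M - F^T *m F.
have FQ : F *m Q = 0 by rewrite mulmxBr mulmx1 mulmxA FF mul1mx subrr.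
have QF : Q *m F^T = 0 by rewrite mulmxBl mul1mx -mulmxA FF mulmx1 subrr.
exists f, Y, Y', D, (Q *m S1 *m Q); split=> //.
- move=> i; apply/negP => /eqP fi0.
  have := congr1 (fun A : 'M[C]_k => A i i) YF.
  rewrite mul_selection_tr !mxE eqxx fi0 => Yi0.
  have /matrixP/(_ i 0) := Y0; rewrite !mxE => E; move: Yi0; rewrite E.
  by move/eqP; rewrite eq_sym oner_eq0.
- split=> //; first by rewrite -mul_selection_tr.
    by rewrite -mul_selection.
  apply/rowP => j; rewrite !mxE; have /matrixP/(_ j 0) := Y0; rewrite !mxE => ->.
  by rewrite rmorph0.
- split; first by rewrite -mul_selection !mulmxA FQ !mul0mx.
  by rewrite -mul_selection_tr -(mulmxA _ Q) QF mulmx0.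
- have YQ : Y *m Q = Y - F by rewrite mulmxBr mulmx1 mulmxA YF mul1mx.
  have QY' : Q *m Y' = Y' - F^T by rewrite mulmxBl mul1mx -mulmxA FY' mulmx1.
  have E1 : (1%:M - F^T *m Y) *m Q = 1%:M - F^T *m Y.
    by rewrite mulmxBl mul1mx -mulmxA YQ mulmxBr opprB addrA subrK.
  have E2 : Q *m (1%:M - Y' *m F) = 1%:M - Y' *m F.
    by rewrite mulmxBr mulmx1 mulmxA QY' mulmxBl opprB addrA subrK.
  have E3 : (1%:M - F^T *m Y) *m (Q *m S1 *m Q) *m (1%:M - Y' *m F) = S1.
    rewrite 2!mulmxA E1 -mulmxA E2.
    rewrite [_ *m S1]mulmxBl mul1mx -[_ *m Y *m S1]mulmxA YS1 mulmx0 subr0.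
    by rewrite mulmxBr mulmx1 mulmxA S1Y' mul0mx subr0.
  by rewrite /normal_form -/F E3 addrC subrK.
Qed.

End InvariantSubspace.

(* The matrices considered are values of a polynomial map in
   (n+1)^2 - 2k + d < (n+1)^2 variables. *)
Lemma normal_form_avoidance (C : numClosedFieldType) (k n d : nat)
    (f : {ffun 'I_k -> 'I_n.+1}) (A : 'I_d -> 'M[C]_n.+1) :
  (d < k.*2)%N -> injective f -> (forall i, f i != 0) ->
  exists F : 'M[C]_n.+1 -> C,
    [/\ line_polynomial F, exists a, F a != 0 &
     forall Y Y' D B (s : 'I_d -> C),
       [/\ colsub f Y = 1%:M, rowsub f Y' = 1%:M, col 0 Y = 0 & row 0 Y' = 0] ->
       rowsub f B = 0 /\ colsub f B = 0 ->
       F (normal_form f Y Y' D B + \sum_l s l *: A l) = 0].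
Proof.
move=> dk f_inj f0.
pose G := {j : 'I_n.+1 | j \notin codom f}.
pose G0 := {j : 'I_n.+1 | (j != 0) && (j \notin codom f)}.
(* One variable for each free entry of Y, Y', D, B and each coefficient [s l]: 2k(n-k) + k^2 +
   (n+1-k)^2 + d = (n+1)^2 - 2k + d. *)
pose T := ((('I_k * G0) + (G0 * 'I_k)) + ('I_k * 'I_k) + (G * G) + 'I_d)%type.
have cardG : (k + #|{: G}| = n.+1)%N.
  by rewrite card_sig -[RHS]card_ord -(cardC [in codom f]) card_codom ?card_ord.
have cardG0 : (#|{: G}| = #|{: G0}|.+1)%N.
  rewrite !card_sig (cardD1 0) inE.
  have -> : 0 \notin codom f.
    by apply/negP => /codomP[i fi]; have := f0 i; rewrite -fi eqxx.
  by rewrite add1n; congr _.+1; apply: eq_card => j; rewrite !inE.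
have ltT : (#|{: T}| < #|{: 'I_n.+1 * 'I_n.+1}|)%N.
  have arith m c c0 : (k + c = m -> c = c0.+1 ->
      k * c0 + c0 * k + k * k + c * c + d < m * m)%N by move=> *; subst; nia.
  by rewrite !card_sum !card_prod !card_ord; exact: arith cardG cardG0.
pose q := #|{: T}|.
pose var (t : T) : mpoly q C := mpolyX C (mnm1 (enum_rank t)).
(* At the other entries, [(f i == j)%:R] is the identity on the chosen columns, and 0 at j = 0
   because [f] avoids 0. *)
pose genY : 'M[mpoly q C]_(k, n.+1) := \matrix_(i, j)
  if insub j is Some g then var (inl (inl (inl (inl (i, g : G0))))) else (f i == j)%:R.
pose genY' : 'M[mpoly q C]_(n.+1, k) := \matrix_(j, i)
  if insub j is Some g then var (inl (inl (inl (inr (g : G0, i))))) else (f i == j)%:R.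
pose genD : 'M[mpoly q C]_k := \matrix_(i, j) var (inl (inl (inr (i, j)))).
pose genB : 'M[mpoly q C]_n.+1 := \matrix_(i, j)
  if insub i is Some g then
    if insub j is Some h then var (inl (inr (g : G, h : G))) else 0
  else 0.
pose P := normal_form f genY genY' genD genB +
  \sum_l var (inr l) *: map_mx (@mpolyC q C) (A l).
have [N [c [c0 cP]]] := algebraic_dependence (fun ij => P ij.1 ij.2) ltT.
exists (fun M => \sum_b c b * \prod_ij M ij.1 ij.2 ^+ b ij); split.
- apply: line_polynomial_sum => b.
  have := @line_polynomial_monomial _ 'M[C]_n.+1 (c b) 1
    (fun M => \prod_ij M ij.1 ij.2 ^+ b ij).
  apply; apply: line_polynomial_prod => ij.
  move=> X Z; have [p pE] := line_polynomial_monomial 1 (b ij)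
    (line_polynomial_coord (K := C) ij.1 ij.2) X Z.
  by exists p => z; rewrite -pE mul1r.
- have [y yP] := monomials_free c0; exists (\matrix_(i, j) y (i, j)).
  rewrite (eq_bigr (fun b => c b * \prod_ij y ij ^+ b ij))// => b _.
  by congr (_ * _); apply: eq_bigr => -[i j] _; rewrite mxE.
move=> Y Y' D B s [Yf Y'f Y0 Y'0] [fB Bf].
pose w (t : T) := match t with
  | inl (inl (inl (inl (i, g)))) => Y i (val g)
  | inl (inl (inl (inr (g, i)))) => Y' (val g) i
  | inl (inl (inr (i, j))) => D i j
  | inl (inr (g, h)) => B (val g) (val h)
  | inr l => s l end.
pose v (i : 'I_q) := w (enum_val i).
have evar t : meval v (var t) = w t by rewrite mevalXU /v enum_rankK.
have fnz l : (f l == 0) = false by apply/negbTE/f0.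
have eY : map_mx (meval v) genY = Y.
  apply/matrixP => i j; rewrite !mxE; case: insubP => [g _ <-|]; first exact: evar.
  rewrite rmorph_nat negb_and !negbK => /orP[/eqP ->|/codomP[l ->]].
    by rewrite fnz; have /matrixP/(_ i 0) := Y0; rewrite !mxE => ->.
  by rewrite (inj_eq f_inj); have /matrixP/(_ i l) := Yf; rewrite !mxE => ->.
have eY' : map_mx (meval v) genY' = Y'.
  apply/matrixP => j i; rewrite !mxE; case: insubP => [g _ <-|]; first exact: evar.
  rewrite rmorph_nat negb_and !negbK => /orP[/eqP ->|/codomP[l ->]].
    by rewrite fnz; have /matrixP/(_ 0 i) := Y'0; rewrite !mxE => ->.
  by rewrite (inj_eq f_inj) eq_sym; have /matrixP/(_ l i) := Y'f; rewrite !mxE => ->.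
have eD : map_mx (meval v) genD = D.
  by apply/matrixP => i j; rewrite !mxE evar.
have eB : map_mx (meval v) genB = B.
  apply/matrixP => i j; rewrite !mxE; case: insubP => [g _ <-|]; last first.
    move=> /negPn/codomP[l ->]; have /matrixP/(_ l j) := fB.
    by rewrite !mxE rmorph0.
  case: insubP => [h _ <-|]; first exact: evar.
  move=> /negPn/codomP[l ->]; have /matrixP/(_ (val g) l) := Bf.
  by rewrite !mxE rmorph0.
have eA l : map_mx (meval v) (map_mx (@mpolyC q C) (A l)) = A l.
  by apply/matrixP => i j; rewrite !mxE mevalC.
have -> : normal_form f Y Y' D B + \sum_l s l *: A l = map_mx (meval v) P.
  rewrite map_mxD map_normal_form eY eY' eD eB map_mx_sum; congr (_ + _).
  apply: eq_bigr => l _; rewrite map_mxZ eA; congr (_ *: _).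
  by rewrite [RHS]evar.
rewrite -[RHS](rmorph0 (meval v)) -cP rmorph_sum /=.
apply: eq_bigr => b _; rewrite mevalZ rmorph_prod; congr (_ * _).
by apply: eq_bigr => ij _; rewrite rmorphXn mxE.
Qed.

(** * Excess multiplicity forces degeneracy *)

Section Eigenspaces.
Variable C : numClosedFieldType.
Implicit Types n k : nat.

Definition hyperplane n : 'M[C]_n.+1 := kermx (delta_mx 0 0 : 'cV[C]_n.+1).

Lemma rank_cap_hyperplane n m (U : 'M[C]_(m, n.+1)) :
  (\rank U <= (\rank (U :&: hyperplane n)%MS).+1)%N.
Proof.
set H := hyperplane n; have rH : \rank H = n.
  by rewrite mxrank_ker mxrank_delta subn1.
have := mxrank_sum_cap U H; rewrite rH => E.
have := rank_leq_col (U + H)%MS; lia.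
Qed.

Lemma sub_hyperplane n m (Y : 'M[C]_(m, n.+1)) :
  (Y <= hyperplane n)%MS -> col 0 Y = 0.
Proof. by move=> /sub_kermxP; rewrite colE. Qed.

(** The eigenspace meets the hyperplane in rank at least k, and every subspace of an eigenspace is
    invariant; [Y] keeps k rows of a basis. *)
Lemma invariant_of_multiplicity k n (S : 'M[C]_n.+1) (a : C) :
  (k < \rank (eigenspace S a))%N -> invariant_in_hyperplane k S.
Proof.
move=> ka; set U := (eigenspace S a :&: hyperplane n)%MS.
have kU : (k <= \rank U)%N.
  by rewrite -ltnS; apply: leq_trans ka (rank_cap_hyperplane _).
pose Y := selection C (widen_ord kU) *m row_base U.
have YU : (Y <= U)%MS by apply: submx_trans (submxMl _ _) _; rewrite eq_row_base.
move: YU; rewrite sub_capmx => /andP[/eigenspaceP YS /sub_hyperplane Y0].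
exists Y, a%:M; split=> //; last by rewrite mul_scalar_mx.
rewrite /row_free mxrankMfree ?row_base_free//.
apply/row_freeP; exists (selection C (widen_ord kU))^T.
by rewrite mul_selection_tr; apply/matrixP => i j; rewrite !mxE.
Qed.

(** Each multiple eigenspace contains a nonzero vector of the hyperplane; such vectors for distinct
    eigenvalues are independent and span an invariant space. *)
Lemma invariant_of_multiple_eigenvalues k n (S : 'M[C]_n.+1) (a : 'I_k -> C) :
  injective a -> (forall i, 1 < \rank (eigenspace S (a i)))%N ->
  invariant_in_hyperplane k S.
Proof.
move=> a_inj ra; pose H := hyperplane n.
have /choice[y yP] i : exists v : 'rV[C]_n.+1,
    (v <= eigenspace S (a i) :&: H)%MS /\ v != 0.
  have /rowV0Pn[v vU v0] : (eigenspace S (a i) :&: H)%MS != 0.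
    rewrite -mxrank_eq0 -lt0n -ltnS; apply: leq_trans (ra i) _.
    exact: rank_cap_hyperplane.
  by exists v.
have yE i : y i *m S = a i *: y i.
  by apply/eigenspaceP; have [] := yP i; rewrite sub_capmx => /andP[].
pose Y := \matrix_i y i; exists Y, (diag_mx (\row_i a i)); split.
- rewrite -kermx_eq0; apply/rowV0P => v /sub_kermxP vY.
  have dx : mxdirect (\sum_i eigenspace S (a i)).
    by apply: mxdirect_sum_eigenspace; exact: in2W.
  have [w _ _ w_uniq] := sub_dsumsmx dx (sub0mx 1 _).
  apply/rowP => i; rewrite mxE.
  have E1 : v 0 i *: y i = w i.
    apply: (w_uniq (fun i => v 0 i *: y i)) => // [j _|].
      by apply: scalemx_sub; have [] := yP j; rewrite sub_capmx => /andP[].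
    rewrite -[LHS]vY mulmx_sum_row; apply: eq_bigr => j _.
    by rewrite rowK.
  have E2 : 0 = w i.
    by apply: (w_uniq (fun=> 0)) => // [j _|]; rewrite ?sub0mx// big1.
  move/eqP: E1; rewrite -E2 scaler_eq0 => /orP[/eqP//|/eqP yi0].
  by have [_] := yP i; rewrite yi0 eqxx.
- apply: sub_hyperplane; apply/row_subP => i; rewrite rowK.
  by have [] := yP i; rewrite sub_capmx => /andP[].
- apply/row_matrixP => i; rewrite !row_mul rowK yE row_diag_mx mxE.
  by rewrite -scalemxAl -rowE rowK.
Qed.

End Eigenspaces.

(** Turns a failure of (3) into an injective family of eigenvalues. *)
Lemma card_le_II_of_noninj (T : Type) (A : set T) (m : nat) :
  ~ (exists a : 'I_m.+1 -> T, injective a /\ forall i, A (a i)) ->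
  (A #<= `I_m)%card.
Proof.
move=> H; suff [p pm Ap] : exists2 p, (p <= m)%N & (A #<= `I_p)%card.
  by apply: card_le_trans Ap _; rewrite card_le_II.
apply: contrapT => H2; apply: H.
have : (`I_m.+1 #<= A)%card.
  have [/finite_setP[p Ap]|/infiniteP] := pselect (finite_set A).
    have mp : (m < p)%N.
      rewrite ltnNge; apply/negP => pm; apply: H2; exists p => //.
      by move/card_eqPle: Ap => [].
    apply: card_le_trans (_ : (`I_m.+1 #<= `I_p)%card) _.
      by rewrite card_le_II.
    by move/card_eqPle: Ap => [].
  exact: card_le_trans (card_leT _).
move=> /card_leP[g].
have gm (i : 'I_m.+1) : `I_m.+1 (i : nat) by exact: ltn_ord.
exists (fun i => val (g (SigSub (mem_set (gm i))))); split=> [i j|i].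
  move=> /val_inj/('inj_g (mem_set I) (mem_set I))/(congr1 val) /=.
  exact: val_inj.
by have := valP (g (SigSub (mem_set (gm i)))); rewrite inE.
Qed.

(** * Generic Hermitian matrices *)

Section Hermitian.
Variables (C : numClosedFieldType) (n : nat).
Local Open Scope sesquilinear_scope.
Local Notation "M ^t*" := (M ^t (@Num.conj C)) (at level 30) : ring_scope.
Implicit Types A B : 'M[C]_n.

Lemma hermsymmxP A : reflect (A = A^t*) (A \is hermsymmx).
Proof.
apply: (iffP (is_hermitianmxP _ _ _)) => [|AE]; first by rewrite expr0 scale1r.
by rewrite expr0 scale1r.
Qed.

Lemma hermsymmx0 : (0 : 'M[C]_n) \is hermsymmx.
Proof. by apply/hermsymmxP; rewrite trmx0 map_mx0. Qed.

Lemma hermsymmxD A B :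
  A \is hermsymmx -> B \is hermsymmx -> A + B \is hermsymmx.
Proof.
by move=> /hermsymmxP hA /hermsymmxP hB; apply/hermsymmxP; rewrite linearD map_mxD -hA -hB.
Qed.

Lemma hermsymmxZ (t : C) A :
  t \is Num.real -> A \is hermsymmx -> t *: A \is hermsymmx.
Proof.
move=> /CrealP tR /hermsymmxP hA; apply/hermsymmxP.
by rewrite linearZ map_mxZ /= tR -hA.
Qed.

Lemma hermsymmx_segment (t : C) A B : t \is Num.real ->
  A \is hermsymmx -> B \is hermsymmx -> A + t *: (B - A) \is hermsymmx.
Proof.
move=> tR hA hB; apply: hermsymmxD => //; apply: hermsymmxZ => //.
by apply: hermsymmxD => //; rewrite -scaleN1r; apply: hermsymmxZ; rewrite ?realN ?real1.
Qed.

Lemma hermsymmx_sum (I : Type) (s : seq I) (A : I -> 'M[C]_n) :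
  (forall i, A i \is hermsymmx) -> \sum_(i <- s) A i \is hermsymmx.
Proof.
move=> hA; elim/big_rec: _ => [|i B _ hB]; first exact: hermsymmx0.
exact: hermsymmxD.
Qed.

Lemma hermsymmx_cartesian A : exists H K : 'M[C]_n,
  [/\ H \is hermsymmx, K \is hermsymmx & A = H + 'i *: K].
Proof.
have dK : (A^t*)^t* = A.
  by apply/matrixP => i j; rewrite !mxE conjCK.
exists (2^-1 *: (A + A^t*)), ('i *: (2^-1 *: (A^t* - A))); split.
- apply: hermsymmxZ; first by rewrite rpredV realn.
  by apply/hermsymmxP; rewrite linearD map_mxD dK addrC.
- rewrite scalerA mulrC -scalerA; apply: hermsymmxZ; first by rewrite rpredV realn.
  apply/hermsymmxP/matrixP => i j; rewrite !mxE rmorphM rmorphB /= conjCi conjCK.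
  by rewrite mulNr -mulrN opprB.
apply/matrixP => i j; rewrite !mxE [X in _ + X]mulrA -expr2 sqrCi mulN1r.
by field.
Qed.

End Hermitian.

(* A complex polynomial vanishing on the real form of Hermitian matrices
   vanishes identically, so its zeros there have empty interior. *)
Lemma line_polynomial_hermsymmx (C : numClosedFieldType) (n : nat)
    (F : 'M[C]_n -> C) (H : 'M[C]_n) :
  line_polynomial F -> (exists A, F A != 0) ->
  exists2 K : 'M[C]_n, K \is hermsymmx &
    forall m, exists k : nat, (m < k)%N /\ F (H + k%:R^-1 *: (K - H)) != 0.
Proof.
move=> lF [A FA].
have [H1 [H2 [hH1 hH2 AE]]] := hermsymmx_cartesian A.
(* The line H1 + z H2 meets [A] at z = i and Hermitian matrices at real z, so [F] is nonzero at some
   Hermitian [K]. *)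
have [p pE] := lF H1 H2.
have p0 : p != 0.
  by apply: contraNneq FA => p0; rewrite AE pE p0 horner0.
have [l [_ pl]] := poly_nonroot p0 0.
exists (H1 + l%:R^-1 *: H2).
  by apply: hermsymmxD => //; apply: hermsymmxZ; rewrite ?rpredV ?realn.
set K := H1 + _.
have FK : F K != 0 by rewrite pE.
have [r rE] := lF H (K - H).
have r0 : r != 0.
  apply: contraNneq FK => r0; have := rE 1.
  by rewrite scale1r addrC subrK r0 horner0 => ->.
move=> m; have [k [mk rk]] := poly_nonroot r0 m.
by exists k; rewrite rE.
Qed.

(** * The entrywise sum norm *)

Section SumNorm.
Variables (R : realType) (n : nat).
Implicit Types A B : 'M[R[i]]_n.

(** Bounds the operator norm from above and, up to the factor n^2, from below; it gives the same
    topology and is computed entrywise. *)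
Definition sumnorm A : R := \sum_i \sum_j normc (A i j).

Lemma sumnormD A B : sumnorm (A + B) <= sumnorm A + sumnorm B.
Proof.
rewrite -big_split; apply: ler_sum => i _; rewrite -big_split.
by apply: ler_sum => j _; rewrite mxE; exact: le_normcD.
Qed.

Lemma sumnormZ (c : R[i]) A : sumnorm (c *: A) = normc c * sumnorm A.
Proof.
rewrite mulr_sumr; apply: eq_bigr => i _; rewrite mulr_sumr.
by apply: eq_bigr => j _; rewrite mxE normcM.
Qed.

Lemma normc_real (t : R) : normc t%:C = `|t|.
Proof. by rewrite /normc /= expr0n addr0 sqrtr_sqr. Qed.

Lemma sumnormZr (t : R) A : sumnorm (t%:C *: A) = `|t| * sumnorm A.
Proof. by rewrite sumnormZ normc_real. Qed.

Lemma sumnormN A : sumnorm (- A) = sumnorm A.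
Proof. by rewrite -scaleN1r -(rmorphN1 (real_complex R)) sumnormZr normrN1 mul1r. Qed.

Lemma sumnormB A B : sumnorm (A - B) = sumnorm (B - A).
Proof. by rewrite -sumnormN opprB. Qed.

Lemma sumnorm_sum (I : Type) (s : seq I) (F : I -> 'M[R[i]]_n) :
  sumnorm (\sum_(i <- s) F i) <= \sum_(i <- s) sumnorm (F i).
Proof.
elim/big_rec2: _ => [|i y x _ ih].
  by rewrite -(scale0r 0) -(rmorph0 (real_complex R)) sumnormZr normr0 mul0r.
by apply: le_trans (sumnormD _ _) _; rewrite lerD2l.
Qed.

Lemma opnorm_le_sumnorm A : opnorm A <= sumnorm A.
Proof. exact: opnorm_le_sum. Qed.

Lemma sumnorm_le_opnorm A : sumnorm A <= opnorm A *+ (n * n).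
Proof.
have -> : opnorm A *+ (n * n) = \sum_(i < n) \sum_(j < n) opnorm A.
  by rewrite !sumr_const !card_ord -mulrnA.
by apply: ler_sum => i _; apply: ler_sum => j _; exact: normc_le_opnorm.
Qed.

End SumNorm.

Lemma complexr_real (R : rcfType) (t : R) : t%:C \is Num.real.
Proof. by rewrite realE -(rmorph0 (real_complex R)) !lecR le_total. Qed.

Lemma seq_max (J : seq nat) : J != [::] ->
  exists2 m, m \in J & forall j, j \in J -> (j <= m)%N.
Proof.
elim: J => // j [|l J] ih _; first by exists j => [|i]; rewrite inE// => /eqP ->.
have [//|m mJ mmax] := ih; case: (leqP m j) => mj.
  exists j; first by rewrite mem_head.
  by move=> i; rewrite inE => /orP[/eqP ->//|/mmax im]; exact: leq_trans mj.
exists m; first by rewrite inE mJ orbT.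
by move=> i; rewrite inE => /orP[/eqP ->|/mmax//]; exact: ltnW.
Qed.

(** * Perturbation to generic points *)

Section GenericPoints.
Variables (R : realType) (n k d : nat).
Local Notation M := 'M[R[i]]_n.+1.

Lemma avoid_near (S : M) (delta : R) (F : M -> R[i]) :
  S \is hermsymmx -> 0 < delta -> line_polynomial F -> (exists A, F A != 0) ->
  exists H, [/\ H \is hermsymmx, sumnorm (S - H) < delta & F H != 0].
Proof.
move=> hS d0 lF F0; have [K hK KP] := line_polynomial_hermsymmx S lF F0.
(* For k' above this quotient, a step of 1/k' toward [K] is shorter than [delta]. *)
have [k' [mk FH]] := KP (Num.truncn (sumnorm (K - S) / delta)).
have kC : (k'%:R^-1 : R[i]) = (k'%:R^-1 : R)%:C by rewrite fmorphV rmorph_nat.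
exists (S + k'%:R^-1 *: (K - S)); split; last exact: FH.
  by apply: hermsymmx_segment hS hK; rewrite rpredV realn.
have k0 : 0 < (k'%:R : R) by rewrite ltr0n (leq_ltn_trans _ mk).
rewrite sumnormB addrAC subrr add0r kC sumnormZr ger0_norm ?invr_ge0 ?ltW//.
rewrite mulrC ltr_pdivrMr// mulrC -ltr_pdivrMr//.
by apply: lt_le_trans (truncnS_gt _) _; rewrite ler_nat.
Qed.

(** Each choice of columns and of d matrices from [s] gives one nonzero polynomial; there are
    finitely many, and [H] avoids the zeros of their product. *)
Lemma generic_point (s : seq M) (S : M) (delta : R) :
  (d < k.*2)%N -> S \is hermsymmx -> 0 < delta ->
  exists H, [/\ H \is hermsymmx, sumnorm (S - H) < delta &
    forall (J : seq nat) (t : nat -> R[i]) (S' : M), (size J <= d)%N ->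
      S' \is hermsymmx -> invariant_in_hyperplane k S' ->
      H <> S' + \sum_(j <- J) t j *: nth 0 s j].
Proof.
move=> dk hS d0.
(* The extra index [size s] reads the default 0 of [nth]; it pads lists [J] shorter than d and
   stands for indices beyond [s]. *)
pose I := ({ffun 'I_k -> 'I_n.+1} * {ffun 'I_d -> 'I_(size s).+1})%type.
have /choice[F FP] (fJ : I) : exists F : M -> R[i],
    [/\ line_polynomial F, exists A, F A != 0 &
     injective fJ.1 -> (forall i, fJ.1 i != 0) ->
     forall Y Y' D B (t : 'I_d -> R[i]),
       [/\ colsub fJ.1 Y = 1%:M, rowsub fJ.1 Y' = 1%:M, col 0 Y = 0 & row 0 Y' = 0] ->
       rowsub fJ.1 B = 0 /\ colsub fJ.1 B = 0 ->
       F (normal_form fJ.1 Y Y' D B + \sum_l t l *: nth 0 s (fJ.2 l)) = 0].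
  have [[f_inj f0]|bad] := pselect (injective fJ.1 /\ forall i, fJ.1 i != 0).
    have [F [lF F0 FP]] := normal_form_avoidance (fun l => nth 0 s (fJ.2 l)) dk f_inj f0.
    by exists F.
  exists (fun=> 1); split=> [A B||? ?]; last by case: bad.
    by exists 1 => z; rewrite hornerC.
  by exists 0; rewrite oner_neq0.
have [] := @avoid_near S delta (fun A => \prod_(fJ : I) F fJ A) hS d0.
- by apply: line_polynomial_prod => fJ; have [] := FP fJ.
- by apply: line_polynomial_prod_neq0 => fJ; have [] := FP fJ.
move=> H [hH SH /prodf_neq0 FH]; exists H; split=> // J t S' Jd hS' bS' HE.
have [f [Y [Y' [D [B [f_inj f0 Yf Bf S'E]]]]]] := hermitian_normal_form hS' bS'.
pose idx : {ffun 'I_d -> 'I_(size s).+1} :=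
  [ffun l : 'I_d => inord (if (l < size J)%N then minn (nth 0%N J l) (size s) else size s)].
have [_ _ /(_ f_inj f0 Y Y' D B (fun l => t (nth 0%N J l)) Yf Bf) E] := FP (f, idx).
have /negP := FH (f, idx) isT; apply; apply/eqP; rewrite -[RHS]E HE S'E /=.
congr (F _ (_ + _)); rewrite (big_nth 0%N) big_mkord.
rewrite (big_ord_widen d (fun l => t (nth 0%N J l) *: nth 0 s (nth 0%N J l)))//.
rewrite big_mkcond; apply: eq_bigr => l _; rewrite ffunE.
case: ifP => lJ; last first.
  by rewrite inordK// [s`_ _]nth_default// scaler0.
rewrite inordK ?ltnS ?geq_minr//; congr (_ *: _).
case: (leqP (nth 0%N J l) (size s)) => // sl.
by rewrite ![s`_ _]nth_default// ltnW.
Qed.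

(** Each point is generic relative to the earlier ones. Were a combination degenerate, solving for
    the point of largest index would write it as a degenerate matrix plus a combination of at most d
    earlier points. *)
Lemma generic_sequence (S : nat -> M) (delta : nat -> R) :
  (d < k.*2)%N -> (forall m, S m \is hermsymmx) -> (forall m, 0 < delta m) ->
  exists A : nat -> M,
    [/\ forall m, A m \is hermsymmx, forall m, sumnorm (S m - A m) < delta m &
     forall (J : seq nat) (t : nat -> R), uniq J -> J != [::] -> (size J <= d.+1)%N ->
       (forall j, j \in J -> 0 < t j) ->
       ~ invariant_in_hyperplane k (\sum_(j <- J) (t j)%:C *: A j)].
Proof.
move=> dk hS d0.
have /choice[next nextP] (s : seq M) := generic_point s dk (hS (size s)) (d0 (size s)).
pose pre m := iter m (fun s => rcons s (next s)) [::].
have size_pre m : size (pre m) = m by elim: m => //= m ih; rewrite size_rcons ih.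
pose A m := next (pre m).
have preA m j : (j < m)%N -> nth 0 (pre m) j = A j.
  elim: m => // m ih; rewrite ltnS leq_eqVlt /= nth_rcons size_pre.
  by case: ltngtP => //= [/ih//|->].
have hA m : A m \is hermsymmx by have [] := nextP (pre m).
exists A; split=> // [m|J t uJ J0 Jd tJ].
  by have [_ + _] := nextP (pre m); rewrite size_pre.
have [m mJ mmax] := seq_max J0.
have tm := tJ _ mJ.
have tmC : (t m)%:C != 0 by rewrite (fmorph_eq0 (real_complex R)) gt_eqF.
set S0 := \sum_(j <- J) _ => -[Y [N [fY Y0 YN]]].
have S0E : S0 = (t m)%:C *: A m + \sum_(j <- rem m J) (t j)%:C *: A j.
  by rewrite /S0 (perm_big _ (perm_to_rem mJ)) big_cons.
have [_ _ H] := nextP (pre m).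
apply: (H (rem m J) (fun j => - ((t j)%:C / (t m)%:C)) ((t m)%:C^-1 *: S0)).
- by rewrite size_rem//; case: (size J) Jd.
- apply: hermsymmxZ; first by rewrite rpredV complexr_real.
  apply: hermsymmx_sum => j.
  by apply: hermsymmxZ; rewrite ?complexr_real.
- exists Y, ((t m)%:C^-1 *: N); split=> //.
  by rewrite -scalemxAr YN scalemxAl.
rewrite -/(A m) (eq_big_seq (fun j => - ((t m)%:C^-1 *: ((t j)%:C *: A j)))).
  by rewrite sumrN -scaler_sumr S0E scalerDr scalerA mulVf// scale1r addrK.
move=> j; rewrite mem_rem_uniq// inE => /andP[jm /mmax]; rewrite leq_eqVlt (negbTE jm) /=.
by move=> /preA ->; rewrite scaleNr scalerA mulrC.
Qed.

End GenericPoints.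

(** * Covers and subordinate functions *)

(* The i-th function is a Urysohn function separating the complement of [W i]
   from the points covered neither by the supports already constructed nor by a
   later [W j]; this only needs point-finiteness of [W]. *)
Lemma normal_subordinate_functions (R : realType) (X : topologicalType)
    (W : nat -> set X) :
  normal_space X -> (forall i, open (W i)) -> \bigcup_i W i = setT ->
  (forall x, exists N, forall i, (N <= i)%N -> ~ W i x) ->
  exists psi : nat -> X -> R,
    [/\ forall i, continuous (psi i), forall i x, 0 <= psi i x,
        forall i x, 0 < psi i x -> W i x & forall x, exists i, 0 < psi i x].
Proof.
move=> nX oW cW fW.
(* Invariant of the recursion: [P] is the open set where an earlier function is positive, and the
   [W j] with j >= i cover the rest. *)
pose good i (P : set X) := open P /\ P `|` \bigcup_(j in [set j | (i <= j)%N]) W j = setT.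
have /choice[u uP] (iP : nat * set X) : exists u : X -> R, good iP.1 iP.2 ->
    [/\ continuous u, forall x, 0 <= u x, forall x, 0 < u x -> W iP.1 x &
     good iP.1.+1 (iP.2 `|` [set x | 0 < u x])].
  case: iP => i P /=; have [[oP cP]|bad] := pselect (good i P); last by exists (fun=> 0).
  pose Q := P `|` \bigcup_(j in [set j | (i < j)%N]) W j.
  have oQ : open Q by apply: openU => //; apply: bigcup_open => j _; exact: oW.
  have QW : ~` W i `&` ~` Q = set0.
    rewrite -setCU -[RHS]setCT; congr (~` _); rewrite -subTset => x _.
    have : setT x by []. rewrite -cP => -[Px|[j /= ij Wx]]; first by right; left.
    move: ij; rewrite leq_eqVlt => /orP[/eqP E|ij]; first by left; rewrite E.
    by right; right; exists j.
  have /normal_separatorP := nX => /(_ R) sep.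
  have := sep (~` W i) (~` Q) (open_closedC (oW i)) (open_closedC oQ) QW.
  move=> /(@uniform_separatorP _ R)[u [cu u01 u0 u1]]; exists u => _.
  have u_ge0 x : 0 <= u x.
    by have := u01 (u x); rewrite /= in_itv /= => /(_ (ex_intro2 _ _ x I erefl))/andP[].
  split=> // [x ux|].
    apply: contrapT => Wx; have : u x = 0 by apply: u0; exists x.
    by move=> ux0; rewrite ux0 ltxx in ux.
  split.
    apply: openU => //; rewrite (_ : [set x | _] = u @^-1` [set t | 0 < t])//.
    by apply: open_comp => //; exact: open_gt.
  rewrite -subTset => x _; have [Qx|Qx] := pselect (Q x).
    by case: Qx => [Px|[j ij Wj]]; [left; left|right; exists j].
  left; right; rewrite /= (_ : u x = 1) ?ltr01//.
  by apply: u1; exists x.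
pose P := fix P i := if i is j.+1 then P j `|` [set x | 0 < u (j, P j) x] else set0.
have gP i : good i (P i).
  elim: i => [|i ih]; last by have [] := uP (i, P i) ih.
  split; first exact: open0.
  by rewrite set0U -cW; apply/seteqP; split=> x [j _ Wj]; exists j.
exists (fun i => u (i, P i)); split.
- by move=> i; have [] := uP (i, P i) (gP i).
- by move=> i; have [] := uP (i, P i) (gP i).
- by move=> i; have [] := uP (i, P i) (gP i).
move=> x; have [N NW] := fW x.
have PN : P N x.
  have [_ cN] := gP N; have : setT x by []. rewrite -cN => -[//|[j /= Nj Wx]].
  by have := NW _ Nj.
elim: N PN {NW} => [//|N ih] /= [/ih//|uN].
by exists N.
Qed.

(** [V i] asks that u_i be positive and every earlier u_j be below 1/(i+1). The first positive u_i
    covers x; if u_j(x) > 0, then u_j > u_j(x)/2 near x, which excludes all large i. *)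
Lemma locally_finite_refinement (R : realType) (X : topologicalType)
    (u : nat -> X -> R) :
  (forall i, continuous (u i)) -> (forall x, exists i, 0 < u i x) ->
  exists V : nat -> set X,
    [/\ forall i, open (V i), \bigcup_i V i = setT, forall i x, V i x -> 0 < u i x &
        forall x : X, exists N, \forall y \near x, forall i, (N <= i)%N -> ~ V i y].
Proof.
move=> cu u0.
pose V i := [set x | 0 < u i x] `&` \bigcap_(j < i) [set x | u j x < i.+1%:R^-1].
exists V; split.
- move=> i; apply: openI.
    rewrite (_ : [set x | _] = u i @^-1` [set t | 0 < t])//.
    by apply: open_comp => //; exact: open_gt.
  rewrite bigcap_mkord; elim/big_rec: _ => [|j A _ oA]; first exact: openT.
  apply: openI => //; rewrite (_ : [set x | _] = u j @^-1` [set t | t < i.+1%:R^-1])//.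
  by apply: open_comp => //; exact: open_lt.
- rewrite -subTset => x _.
  have ex : exists i, `[< 0 < u i x >] by have [i ui] := u0 x; exists i; apply/asboolP.
  case: (ex_minnP ex) => i /asboolP ui imin; exists i => //; split=> // j /= ji.
  apply: (@le_lt_trans _ _ 0); last by rewrite invr_gt0.
  by rewrite leNgt; apply/negP => uj; have := imin j; rewrite leqNgt ji => /(_ (asboolT uj)).
- by move=> i x [].
move=> x; have [j uj] := u0 x.
exists (maxn j.+1 (Num.truncn (u j x / 2)^-1).+1).
have a0 : 0 < u j x / 2 by rewrite divr_gt0.
near=> y => i; rewrite geq_max => /andP[ji ti] [_ /(_ j ji) /=].
apply/negP; rewrite -leNgt; apply: (@le_trans _ _ (u j x / 2)).
  rewrite invf_ple ?posrE//; apply/ltW.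
  by apply: lt_le_trans (truncnS_gt _) _; rewrite ler_nat leqW.
rewrite ltW//; near: y.
have : u j @ x --> u j x by exact: cu.
by move=> /cvgr_gt; apply; rewrite ltr_pdivrMr// ltr_pMr// ltr1n.
Unshelve. all: by end_near. Qed.

(** Members of a refinement assigned to the same [V i] are merged. This makes the index set [nat]
    again and does not raise the number of members at a point. *)
Lemma indexed_refinement (X : topologicalType) (d : nat) (V : nat -> set X) :
  covering_dim_le X d -> (forall i, open (V i)) -> \bigcup_i V i = setT ->
  exists W : nat -> set X,
    [/\ forall i, open (W i), \bigcup_i W i = setT, forall i, W i `<=` V i &
        forall x, ([set i | W i x] #<= `I_d.+1)%card].
Proof.
move=> dX oV cV; have [J [U [[oU cU] rU ordU]]] := dX nat V (conj oV cV).
have [r rP] := choice rU.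
exists (fun i => \bigcup_(j in [set j | r j = i]) U j); split.
- by move=> i; apply: bigcup_open => j _; exact: oU.
- rewrite -subTset => x; rewrite -cU => -[j _ Ujx]; exists (r j) => //; by exists j.
- by move=> i x [j /= <- Ujx]; exact: rP Ujx.
move=> x; apply: card_le_trans (ordU x).
apply: card_le_trans (card_image_le r [set j | U j x]).
by apply: subset_card_le => i [j /= <- Ujx]; exists j.
Qed.

Lemma size_le_card (A : set nat) (J : seq nat) (m : nat) :
  (A #<= `I_m)%card -> uniq J -> {in J, forall j, A j} -> (size J <= m)%N.
Proof.
move=> Am uJ JA; rewrite -card_le_II; apply: card_le_trans Am.
apply/pcard_leP/injfunPex; exists (nth 0%N J) => [i /= iJ|i j].
  exact/JA/mem_nth.
by rewrite !inE /= => iJ jJ /eqP; rewrite nth_uniq// => /eqP.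
Qed.

(** * Approximation of matrix-valued maps *)

Section MatrixMaps.
Variables (R : realType) (n : nat) (X : topologicalType).
Local Notation M := 'M[R[i]]_n.
Implicit Types f : X -> M.

Lemma continuous_sumnormP f : continuous f <->
  forall x (e : R), 0 < e -> \forall y \near x, sumnorm (f x - f y) < e.
Proof.
split=> [cf x e e0|cf x U].
  have : nbhs (f x) [set B | sumnorm (f x - B) < e].
    apply/nbhs_opnormP; exists (e / (n * n).+1%:R); first by rewrite divr_gt0.
    move=> B /ltW fB /=; apply: le_lt_trans (sumnorm_le_opnorm _) _.
    apply: (@le_lt_trans _ _ (e / (n * n).+1%:R *+ (n * n))); first by rewrite lerMn2r fB orbT.
    rewrite -[ltLHS]mulr_natl mulrCA -[ltRHS]mulr1 ltr_pM2l// ltr_pdivrMr// mul1r.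
    by rewrite ltr_nat.
  exact: cf.
move=> /nbhs_opnormP[e e0 eU]; apply: filterS (cf x e e0) => y fy.
by apply: eU; apply: le_lt_trans (opnorm_le_sumnorm _) fy.
Qed.

Lemma continuous_sumnorm_sub f (c : M) :
  continuous f -> continuous (fun x => sumnorm (f x - c)).
Proof.
move=> /continuous_sumnormP cf x; apply/cvgrPdist_lt => e e0.
apply: filterS (cf x e e0) => y; apply: le_lt_trans.
have tri (A B : M) : sumnorm A <= sumnorm B + sumnorm (B - A).
  by rewrite (sumnormB B) addrC -{1}(subrK B A) sumnormD.
have E : f x - c - (f y - c) = f x - f y by rewrite opprB addrA subrK.
rewrite ler_distl -E; apply/andP; split.
  by rewrite lerBlDr tri//.
have := tri (f x - c) (f y - c); rewrite (sumnormB (f y - c)); lra.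
Qed.

Lemma rational_approximation (A : M) (e : R) : 0 < e ->
  exists q : 'M[rat]_n * 'M[rat]_n,
    sumnorm (A - \matrix_(i, j) ((ratr (q.1 i j))%:C + 'i%C * (ratr (q.2 i j))%:C)) < e.
Proof.
move=> e0; pose e' := e / (n * n).+1%:R / 2.
have e'0 : 0 < e' by rewrite !divr_gt0.
have rat_near (t : R) : exists q, `|t - ratr q| < e'.
  have [q] : exists q, ratr q \in `]t - e', t + e'[%R.
    by apply: rat_in_itvoo; lra.
  by rewrite in_itv /= => /andP[? ?]; exists q; rewrite ltr_distl; apply/andP; split; lra.
have [q1 q1P] := choice rat_near.
exists (\matrix_(i, j) q1 (complex.Re (A i j)), \matrix_(i, j) q1 (complex.Im (A i j))).
apply: (@le_lt_trans _ _ (\sum_(i < n) \sum_(j < n) (e' * 2))).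
  apply: ler_sum => i _; apply: ler_sum => j _; rewrite !mxE /=.
  set a := complex.Re _; set b := complex.Im _.
  have -> : A i j - ((ratr (q1 a))%:C + 'i%C * (ratr (q1 b))%:C) =
      (a - ratr (q1 a))%:C + 'i%C * (b - ratr (q1 b))%:C.
    by rewrite [A i j]complexE !rmorphB /= -/a -/b; ring.
  apply: le_trans (le_normcD _ _) _; rewrite normcM !normc_real.
  have -> : normc ('i%C : R[i]) = 1 by rewrite /normc /= expr0n expr1n add0r sqrtr1.
  by rewrite mul1r mulr2n mulrDr !mulr1 lerD// ltW.
rewrite !sumr_const !card_ord -mulrnA /e' divfK ?pnatr_eq0//.
rewrite -[ltLHS]mulr_natl mulrCA -[ltRHS]mulr1 ltr_pM2l// ltr_pdivrMr// mul1r.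
by rewrite ltr_nat.
Qed.

(* The centers are values of [f] itself, hence Hermitian when [f] is; the
   countable dense set of rational matrices only indexes them. *)
Lemma countable_approximation f (eps : X -> R) :
  continuous f -> continuous eps -> (forall x, f x \is hermsymmx) ->
  (forall x, 0 < eps x) ->
  exists (c : nat -> M) (r : nat -> R) (u : nat -> X -> R),
    [/\ forall m, c m \is hermsymmx, forall m, 0 < r m,
        forall m, continuous (u m), forall x, exists m, 0 < u m x &
        forall m x, 0 < u m x -> sumnorm (f x - c m) + r m <= eps x].
Proof.
move=> cf ceps hf eps0.
pose Q := ('M[rat]_n * 'M[rat]_n * nat)%type.
pose cpx (q : 'M[rat]_n * 'M[rat]_n) : M :=
  \matrix_(i, j) ((ratr (q.1 i j))%:C + 'i%C * (ratr (q.2 i j))%:C).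
pose r (q : Q) : R := q.2.+1%:R^-1.
(* If some value of [f] is within [r q] of the rational matrix, it serves as center; the triangle
   inequality doubles the radius. *)
have /choice[c cP] (q : Q) : exists c : M, c \is hermsymmx /\
    forall x, sumnorm (f x - cpx q.1) < r q -> sumnorm (f x - c) < 2 * r q.
  have [[x0 fx0]|no] := pselect (exists x, sumnorm (f x - cpx q.1) < r q).
    exists (f x0); split=> // x fx.
    have -> : f x - f x0 = (f x - cpx q.1) + (cpx q.1 - f x0) by rewrite addrA subrK.
    apply: le_lt_trans (sumnormD _ _) _; rewrite (sumnormB (cpx q.1)).
    by rewrite mulr_natl mulr2n ltrD.
  exists 0; split; first exact: hermsymmx0.
  by move=> x fx; case: no; exists x.
(* Positive exactly when f(x) is within 2r of the center and 3r < eps(x), which leaves a slack of r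
   for moving the center. *)
pose u q x : R := Num.min (2 * r q - sumnorm (f x - c q)) (eps x - 3 * r q).
have rgt0 q : 0 < r q by rewrite invr_gt0.
have q0 : Q := (0, 0, 0%N).
pose dec m := odflt q0 (unpickle m).
exists (c \o dec), (r \o dec), (u \o dec); split=> /=.
- by move=> m; have [] := cP (dec m).
- by move=> m; exact: rgt0.
- move=> m x; have := @continuous_min R X
    (fun y => 2 * r (dec m) - sumnorm (f y - c (dec m)))
    (fun y => eps y - 3 * r (dec m)) x; apply.
    apply: cvgB; first exact: cvg_cst.
    exact: continuous_sumnorm_sub.
  by apply: cvgB; [exact: ceps|exact: cvg_cst].
- move=> x; pose l := Num.truncn (3 / eps x).
  have [q qP] := @rational_approximation (f x) l.+1%:R^-1 ltac:(by rewrite invr_gt0).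
  exists (pickle (q, l)); rewrite /dec pickleK /= /u lt_min !subr_gt0.
  have [_ /(_ x qP) ->] := cP (q, l); rewrite /r /= ltr_pdivrMr// mulrC -ltr_pdivrMr//.
  exact: truncnS_gt.
move=> m x; rewrite /u lt_min !subr_gt0 => /andP[a b]; move: a b (rgt0 (dec m)); lra.
Qed.

End MatrixMaps.

(** * Weighted means over a locally finite cover *)

Lemma big_ord_support (V : zmodType) (F : nat -> V) (m m' : nat) :
  (forall i, (m <= i)%N -> F i = 0) -> (forall i, (m' <= i)%N -> F i = 0) ->
  \sum_(i < m) F i = \sum_(i < m') F i.
Proof.
wlog mm' : m m' / (m <= m')%N.
  by move=> wl Fm Fm'; have [/wl ->//|/ltnW/wl ->//] := leqP m m'.
move=> Fm _; rewrite -!(big_mkord xpredT F) (@big_cat_nat _ _ _ m 0 m')//=.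
rewrite [X in _ = _ + X]big_nat_cond [X in _ = _ + X]big1 ?addr0// => i.
by rewrite andbT => /andP[/Fm].
Qed.

Lemma cvg_ord_sum (R : realType) (T : Type) (F : set_system T) {FF : Filter F}
    (m : nat) (f : nat -> T -> R) (l : nat -> R) :
  (forall i, f i x @[x --> F] --> l i) ->
  (\sum_(i < m) f i x) @[x --> F] --> \sum_(i < m) l i.
Proof.
move=> fl; elim: m => [|m ih].
  rewrite big_ord0 (_ : (fun x => _) = fun=> 0); first exact: cvg_cst.
  by apply/funext => x; rewrite big_ord0.
rewrite big_ord_recr /= (_ : (fun x => _) = fun x => \sum_(i < m) f i x + f m x).
  exact: cvgD ih (fl m).
by apply/funext => x; rewrite big_ord_recr.
Qed.

Section Assembly.
Variables (R : realType) (X : topologicalType) (n : nat).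
Variables (V : nat -> set X) (psi : nat -> X -> R) (A : nat -> 'M[R[i]]_n) (N : X -> nat).
Hypothesis psi_cont : forall i, continuous (psi i).
Hypothesis psi_ge0 : forall i x, 0 <= psi i x.
Hypothesis psiV : forall i x, 0 < psi i x -> V i x.
Hypothesis psi_pos : forall x, exists i, 0 < psi i x.
Hypothesis VN : forall x : X, \forall y \near x, forall i, (N x <= i)%N -> ~ V i y.

Let mass m x := \sum_(i < m) psi i x.
Let weight m i x := psi i x / mass m x.

(** The bound [N x] may jump with x, but all terms beyond it vanish, and by [weighted_meanE] every
    valid truncation gives the same value. *)
Definition weighted_mean x := \sum_(i < N x) (weight (N x) i x)%:C *: A i.

Let psi0 m x : (forall i, (m <= i)%N -> ~ V i x) ->
  forall i, (m <= i)%N -> psi i x = 0.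
Proof.
move=> mV i mi; apply/eqP; rewrite eq_le psi_ge0 andbT leNgt; apply/negP.
by move=> /psiV; exact: mV.
Qed.

Let NV x : forall i, (N x <= i)%N -> ~ V i x.
Proof. exact: nbhs_singleton (VN x). Qed.

Let mass_gt0 m x : (forall i, (m <= i)%N -> ~ V i x) -> 0 < mass m x.
Proof.
move=> mV; have [j pj] := psi_pos x.
have jm : (j < m)%N by rewrite ltnNge; apply/negP => /mV; apply; exact: psiV.
rewrite /mass (bigD1 (Ordinal jm))//=; apply: ltr_pwDl => //.
by apply: sumr_ge0 => i _.
Qed.

Let weighted_meanE m x : (forall i, (m <= i)%N -> ~ V i x) ->
  weighted_mean x = \sum_(i < m) (weight m i x)%:C *: A i.
Proof.
move=> mV; have E : mass m x = mass (N x) x.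
  by apply: (big_ord_support (F := psi^~ x)); [exact: psi0|exact: psi0 (@NV x)].
rewrite /weight E; apply: (big_ord_support (F := fun i => (weight (N x) i x)%:C *: A i)).
  by move=> i /(psi0 (@NV x)) p0; rewrite /weight p0 mul0r scale0r.
by move=> i /(psi0 mV) p0; rewrite /weight p0 mul0r scale0r.
Qed.

Lemma weighted_mean_continuous : continuous weighted_mean.
Proof.
(* Truncation at m = N x stays valid near x, so only finitely many continuous weights are
   compared. *)
apply/continuous_sumnormP => x e e0; set m := N x.
pose h y := \sum_(i < m) `|weight m i x - weight m i y| * sumnorm (A i).
have cmass : mass m @ x --> mass m x.
  by apply: (@cvg_ord_sum _ _ _ _ _ psi (psi^~ x)) => i; exact: psi_cont.
have ch : h y @[y --> x] --> (0 : R).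
  rewrite (_ : 0 = \sum_(i < m) `|weight m i x - weight m i x| * sumnorm (A i)); last first.
    by rewrite big1// => i _; rewrite subrr normr0 mul0r.
  apply: (@cvg_ord_sum _ _ _ _ _
    (fun i y => `|weight m i x - weight m i y| * sumnorm (A i))
    (fun i => `|weight m i x - weight m i x| * sumnorm (A i))) => i.
  apply: cvgM; last exact: cvg_cst.
  apply: cvg_norm; apply: cvgB; first exact: cvg_cst.
  apply: cvgM; first exact: psi_cont.
  by apply: cvgV => //; rewrite gt_eqF// mass_gt0//; exact: NV.
near=> y.
have hy : h y < e by near: y; exact: cvgr_lt ch _ e0.
have mV : forall i, (m <= i)%N -> ~ V i y by near: y; exact: VN.
rewrite (weighted_meanE (@NV x)) (weighted_meanE mV) -/m -sumrB.
apply: le_lt_trans hy; apply: le_trans (sumnorm_sum _ _) _; apply: ler_sum => i _.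
by rewrite -scalerBl -rmorphB sumnormZr.
Unshelve. all: by end_near. Qed.

Lemma weighted_mean_finite x : exists (J : seq nat) (t : nat -> R),
  [/\ uniq J, J != [::], forall j, j \in J -> V j x /\ 0 < psi j x,
      forall j, j \in J -> 0 < t j &
      \sum_(j <- J) t j = 1 /\ weighted_mean x = \sum_(j <- J) (t j)%:C *: A j].
Proof.
set m := N x; have M0 := mass_gt0 (@NV x).
pose J := [seq i <- iota 0 m | 0 < psi i x].
have sumJ (U : zmodType) (F : nat -> U) : (forall i, psi i x = 0 -> F i = 0) ->
    \sum_(i < m) F i = \sum_(j <- J) F j.
  move=> F0; rewrite big_filter [RHS]big_mkcond -(big_mkord xpredT F) /index_iota subn0.
  apply: eq_bigr => i _.
  case: ifP => // /negbT; rewrite -leNgt => pi; apply: F0.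
  by apply/eqP; rewrite eq_le pi psi_ge0.
have sum1 : \sum_(j <- J) weight m j x = 1.
  rewrite -(sumJ R (fun i => weight m i x)); last by move=> i p0; rewrite /weight p0 mul0r.
  by rewrite -mulr_suml mulfV// gt_eqF.
exists J, (fun j => weight m j x); split; first by rewrite filter_uniq// iota_uniq.
- by apply: contraTneq isT => J0; move: sum1; rewrite J0 big_nil => /eqP; rewrite eq_sym oner_eq0.
- by move=> j; rewrite mem_filter => /andP[pj _]; split=> //; exact: psiV.
- by move=> j; rewrite mem_filter => /andP[pj _]; rewrite divr_gt0.
split=> //; apply: (sumJ _ (fun i => (weight m i x)%:C *: A i)) => i p0.
by rewrite /weight p0 mul0r scale0r.
Qed.

End Assembly.

Lemma convex_combination_close (R : realType) (n : nat) (J : seq nat) (t : nat -> R)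
    (B : 'M[R[i]]_n) (A : nat -> 'M[R[i]]_n) (e : R) :
  J != [::] -> (forall j, j \in J -> 0 < t j) -> \sum_(j <- J) t j = 1 ->
  (forall j, j \in J -> sumnorm (B - A j) < e) ->
  sumnorm (B - \sum_(j <- J) (t j)%:C *: A j) < e.
Proof.
move=> J0 tJ t1 BA.
have -> : B - \sum_(j <- J) (t j)%:C *: A j = \sum_(j <- J) (t j)%:C *: (B - A j).
  rewrite -[X in X - _]scale1r -(rmorph1 (real_complex R)) -t1 rmorph_sum scaler_suml -sumrB.
  by apply: eq_bigr => j _; rewrite scalerBr.
apply: le_lt_trans (sumnorm_sum _ _) _; rewrite -[ltRHS]mul1r -t1 mulr_suml.
rewrite big_seq [ltRHS]big_seq; apply: ltr_sum.
  by case: (J) J0 => //= j J' _; rewrite mem_head.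
move=> j jJ; rewrite sumnormZr gtr0_norm ?tJ// ltr_pM2l ?tJ//; exact: BA.
Qed.

(** * Combining cover, generic points and weights *)

Unset Implicit Arguments.

Theorem theorem5p1 (R : realType) (d : nat) (X : topologicalType)
    (hX : normal_space X) (hdim : has_covering_dim X d)
    (n : nat) (hn : (1 <= n)%N)
    (f : X -> 'M[R[i]]_n) (hf : continuous f)
    (hfsa : forall x, f x \is hermsymmx)
    (eps : X -> R) (heps : continuous eps) (heps0 : forall x, 0 < eps x) :
  exists g : X -> 'M[R[i]]_n,
    [/\ continuous g,
        forall x, g x \is hermsymmx &
        forall x,
          [/\ opnorm (f x - g x) < eps x,
              forall a, eigenvalue (g x) a ->
                (eigenmult (g x) a <= uphalf d + 1)%N &
              ([set a | eigenvalue (g x) a /\ (1 < eigenmult (g x) a)%N]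
                 #<= `I_(uphalf d))%card]].
Proof.
case: n hn f hf hfsa => // n _ f hf hfsa.
(* [uphalf d] is ceil(d/2), so 2k >= d + 2. *)
pose k := (uphalf d).+1.
have dk : (d < k.*2)%N by rewrite /k; lia.
have [c [r [u [hc r0 cu u0 ucr]]]] := countable_approximation hf heps hfsa heps0.
have [V [oV cV Vu fV]] := locally_finite_refinement cu u0.
(* [W i] lies in [V i] for the same i, so it inherits local finiteness while the order drops to at
   most d + 1. *)
have [W [oW cW WV ordW]] := indexed_refinement hdim.1 oV cV.
have [N NV] := choice fV.
have fW x : exists N, forall i, (N <= i)%N -> ~ W i x.
  by exists (N x) => i Ni /WV; exact: (nbhs_singleton (NV x)).
have [psi [cpsi psi_ge0 psiW psi_gt0]] := normal_subordinate_functions R hX oW cW fW.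
(* Each [A m] is within [r m] of the center [c m], which the slack in [ucr] absorbs. *)
have [A [hA cA genA]] := generic_sequence dk hc r0.
have psiV i x : 0 < psi i x -> V i x by move=> /psiW/WV.
exists (weighted_mean psi A N); split.
- exact: weighted_mean_continuous cpsi psi_ge0 psiV psi_gt0 NV.
- move=> x; apply: hermsymmx_sum => i; apply: hermsymmxZ; first exact: complexr_real.
  exact: hA.
move=> x.
have [J [t [uJ J0 JV tJ [t1 gE]]]] := weighted_mean_finite A psi_ge0 psiV psi_gt0 NV x.
(* At most d + 1 members of [W] contain x, so g(x) is a positive combination of at most d + 1
   generic points. *)
have good : ~ invariant_in_hyperplane k (weighted_mean psi A N x).
  rewrite gE; apply: genA => //; apply: (size_le_card (ordW x)) => // j /JV[_].
  exact: psiW.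
split.
- apply: le_lt_trans (opnorm_le_sumnorm _) _; rewrite gE.
  apply: convex_combination_close => // j /JV[/Vu uj _].
  apply: lt_le_trans (ucr _ _ uj).
  have -> : f x - A j = (f x - c j) + (c j - A j) by rewrite addrA subrK.
  by apply: le_lt_trans (sumnormD _ _) _; rewrite ltrD2l.
- move=> a _; rewrite addn1 leqNgt; apply/negP => /invariant_of_multiplicity.
  exact: good.
apply: card_le_II_of_noninj => -[a [a_inj aP]]; apply: good.
by apply: invariant_of_multiple_eigenvalues a_inj _ => i; have [] := aP i.
Qed.
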